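(* For $i=1,2$ let $G_i$ be a simple graph on the vertex set $[n_i]$ and $H_i$ an induced subgraph of $G_i$. Let $\mathbb{K}[\mathbf X]=\mathbb{K}[x_{i,j}: i\in[n_1], j\in[n_2]]$ and $\mathbb{K}[\mathbf Y]=\mathbb{K}[x_{i,j}: i\in V(H_1), j\in V(H_2)]$. Let $\mathcal{J}_{G_1,G_2}\subseteq\mathbb{K}[\mathbf X]$ and $\mathcal{J}_{H_1,H_2}\subseteq\mathbb{K}[\mathbf Y]$ be the binomial edge ideals of the pairs. Then \[\operatorname{reg}(\mathcal{R}(\mathcal{J}_{H_1,H_2}))\le\operatorname{reg}(\mathcal{R}(\mathcal{J}_{G_1,G_2}))\quad\text{and}\quad \operatorname{reg}(\mathcal{F}(\mathcal{J}_{H_1,H_2}))\le\operatorname{reg}(\mathcal{F}(\mathcal{J}_{G_1,G_2})).\]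
   Context: $\mathbb{K}$ is a field. For edges $e=\{i,j\}\in E(G_1)$, $f=\{k,l\}\in E(G_2)$ with $i<j$, $k<l$, $p_{(e,f)}=x_{i,k}x_{j,l}-x_{i,l}x_{j,k}$ and $\mathcal{J}_{G_1,G_2}=(p_{(e,f)}: e\in E(G_1), f\in E(G_2))$; similarly for $(H_1,H_2)$ in the original labels. $\mathcal{R}(I)=\bigoplus_{k\ge0}I^kT^k$ is the Rees algebra and $\mathcal{F}(I)=\mathcal{R}(I)/\mathfrak m\mathcal{R}(I)$ the special fiber ring ($\mathfrak m$ the homogeneous maximal ideal); $\operatorname{reg}$ is Castelnuovo–Mumford regularity. *)

(* Defs.v *)
From HB Require Import structures.
From mathcomp Require Import all_boot all_order all_algebra.
From mathcomp Require Import mpoly.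
Set Implicit Arguments. Unset Strict Implicit. Unset Printing Implicit Defensive.
Import Order.TTheory GRing.Theory Num.Theory.
Local Open Scope ring_scope.

Definition simple_graph (n : nat) (e : rel 'I_n) : Prop :=
  (forall i j, e i j = e j i) /\ (forall i, e i i = false).

(* The induced subgraph of e on the vertex set V, with vertices relabeled
   increasingly by 'I_#|V| (enum_val is the increasing enumeration of V,
   so the order "i < j" of the original labels is preserved). *)
Definition induced (n : nat) (e : rel 'I_n) (V : {set 'I_n}) : rel 'I_#|V| :=
  fun a b => e (enum_val a) (enum_val b).

Section BEI.
Variable K : fieldType.

Definition xv (n1 n2 : nat) (i : 'I_n1) (k : 'I_n2) : {mpoly K[n1 * n2]} :=
  'X_(mxvec_index i k).

Definition bei_gens (n1 n2 : nat) (e1 : rel 'I_n1) (e2 : rel 'I_n2)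
  : seq {mpoly K[n1 * n2]} :=
  [seq (let: (i, j, k, l) := q in xv i k * xv j l - xv i l * xv j k)
  | q <- enum [pred q : 'I_n1 * 'I_n1 * 'I_n2 * 'I_n2 |
                let: (i, j, k, l) := q in
                [&& (i < j)%N, (k < l)%N, e1 i j & e2 k l]]].

Definition liftN (N : nat) (p : {mpoly K[N]}) : {mpoly K[N.+1]} :=
  p \mPo [tuple 'X_(widen_ord (leqnSn N) k) | k < N].

(* Presentation ideal of the Rees algebra R(I) = S[It], I = (f_1..f_m):
   kernel of S[T_1..T_m] -> S[t], x -> x, T_j -> f_j t. *)
Definition rees_ideal (N : nat) (f : seq {mpoly K[N]}) : pred {mpoly K[N + size f]} :=
  fun P => P \mPo [tuple match split k with
                        | inl a => 'X_(widen_ord (leqnSn N) a)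
                        | inr j => liftN f`_j * 'X_(ord_max : 'I_N.+1)
                        end | k < N + size f] == 0.

(* Presentation ideal of the special fiber ring F(I) = K[f_1 .. f_m]:
   kernel of K[T_1..T_m] -> S, T_j -> f_j.  (For I generated by forms of
   one degree, F(I) = R(I)/m R(I) is this algebra.) *)
Definition fiber_ideal (N : nat) (f : seq {mpoly K[N]}) : pred {mpoly K[size f]} :=
  fun P => P \mPo [tuple f`_j | j < size f] == 0.

(* A minimal graded free resolution of A/J over the standard graded polynomial
   ring A = K[M] (all variables of degree 1):
     0 <- A/J <- F_0 <- F_1 <- F_2 <- ... ,  F_i = (+)_{k < b i} A(-d i k),
   the map F_{i+1} -> F_i is v |-> v *m D i (row vectors), D i has homogeneous
   entries of degree d (i+1) k - d i l, minimality = entries lie in the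
   homogeneous maximal ideal (nonzero entries have positive degree). *)
Definition min_graded_res (M : nat) (J : pred {mpoly K[M]})
  (b : nat -> nat) (d : forall i, 'I_(b i) -> nat)
  (D : forall i, 'M[{mpoly K[M]}]_(b i.+1, b i)) : Prop :=
  [/\ b 0%N = 1%N, (forall k, d 0%N k = 0%N),
      (forall p, J p <-> exists u : 'rV_(b 1%N), forall j, (u *m D 0%N) ord0 j = p),
      (forall i, D i.+1 *m D i = 0) &
   [/\ 
(forall i (v : 'rV_(b i.+1)), v *m D i = 0 ->
          exists w : 'rV_(b i.+2), v = w *m D i.+1),
      (forall i k l, D i k l \is (d i.+1 k - d i l)%N.-homog /\
                     (D i k l != 0 -> (d i l < d i.+1 k)%N)) &
      (exists L, forall i, (L < i)%N -> b i = 0%N)]].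

(* reg(A/J) <= r, where reg = max_i (t_i - i), t_i = max shift of F_i in the
   minimal graded free resolution. *)
Definition reg_le (M : nat) (J : pred {mpoly K[M]}) (r : nat) : Prop :=
  exists b d D, @min_graded_res M J b d D /\ (forall i k, (d i k <= r + i)%N).

End BEI.
Arguments rees_ideal {K N} f _.
Arguments fiber_ideal {K N} f _.
Arguments reg_le {K M} J r.
Arguments bei_gens K {n1 n2} e1 e2.
Arguments induced {n} e V _ _.

(* Main.v *)
(** Sending the variables outside V1 x V2, and the T-variables of generators not
    coming from the subgraphs, to zero makes the polynomial ring A presenting
    the algebra of (H1, H2) a graded retract of the polynomial ring B for
    (G1, G2), compatibly with the presentation ideals. From a resolution F over
    B one builds a resolution E over A together with comparison maps
    alpha : E -> F and beta : F (x) A -> E whose composite, read over A, is the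
    identity. The cycles of E are then spanned by the images under beta of the
    generators of F; a minimal spanning subset of them gives the next module, so
    the degrees of the generators of E_i occur among those of F_i. In particular
    neither the Hilbert basis theorem nor the syzygy theorem is needed. *)
Require Import Defs.
From HB Require Import structures.
From mathcomp Require Import all_boot all_order all_algebra.
From mathcomp Require Import mpoly zify.
From Stdlib Require Import ClassicalEpsilon.

Set Implicit Arguments. Unset Strict Implicit. Unset Printing Implicit Defensive.
Import GRing.Theory.
Local Open Scope ring_scope.

(** * Homogeneous matrices between graded free modules *)

Section GradedMatrices.
Variable K : fieldType.

(** Split [p] into homogeneous components: multiplication by [q] shifts each degree by [e], so only
    the component of degree [c - e] reaches degree [c]. *)
Lemma pihomogM_dhomog n (p q : {mpoly K[n]}) c e : q \is e.-homog ->
  pihomog mdeg c (p * q) =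
  if (e <= c)%N then pihomog mdeg (c - e) p * q else 0.
Proof.
move=> hq; set k := maxn (mmeasure mdeg p) c.+1.
rewrite {1}(@pihomog_partitionE n K mdeg k p) ?leq_maxl //.
rewrite mulr_suml raddf_sum /=.
have piE (d : 'I_k) : pihomog mdeg c (pihomog mdeg d p * q) =
    if (d + e == c)%N then pihomog mdeg d p * q else 0.
  have h := dhomogM (pihomogP mdeg d p) hq.
  case: eqP => [<-|/eqP ne]; first by rewrite pihomog_dE.
  exact: pihomog_ne0 ne h.
rewrite (eq_bigr _ (fun d _ => piE d)).
case: leqP => hec; last by rewrite big1 // => d _; case: eqP => //; lia.
have ltk : (c - e < k)%N by rewrite /k leq_max; lia.
rewrite (bigD1 (Ordinal ltk)) //= subnK // eqxx big1 ?addr0 // => d /eqP nd.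
by case: eqP => // hd; case: nd; apply/val_inj => /=; lia.
Qed.

Lemma dhomog0_const n (p : {mpoly K[n]}) : p \is 0.-homog -> p = (p@_0)%:MP.
Proof.
move=> hp; apply/mpolyP => m; rewrite mcoeffC.
case: eqP => [->|nm]; first by rewrite mulr1.
rewrite mulr0; apply: dhomog_nemf_coeff hp _.
by rewrite mdeg_eq0; apply/eqP => e; apply: nm; rewrite e.
Qed.

(* [gmx t dr dc A]: [A] is a degree-preserving map from the graded free module
   with generators in degrees [dr] to that with generators in degrees [dc],
   sending each generator into the summands whose degree is smaller by at
   least [t]. *)
Definition gmx n t r s (dr : 'I_r -> nat) (dc : 'I_s -> nat)
    (A : 'M[{mpoly K[n]}]_(r, s)) : Prop :=
  forall k l, A k l = 0 \/
    (dc l + t <= dr k)%N /\ A k l \is (dr k - dc l).-homog.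

Section Ops.
Variable n : nat.
Implicit Types t : nat.

Lemma gmxW t t' r s (dr : 'I_r -> nat) (dc : 'I_s -> nat)
    (A : 'M[{mpoly K[n]}]_(r, s)) :
  (t' <= t)%N -> gmx t dr dc A -> gmx t' dr dc A.
Proof. by move=> ? hA k l; case: (hA k l) => [->|[? ?]]; [left|right; split=> //; lia]. Qed.

Lemma gmxD t r s (dr : 'I_r -> nat) (dc : 'I_s -> nat)
    (A B : 'M[{mpoly K[n]}]_(r, s)) :
  gmx t dr dc A -> gmx t dr dc B -> gmx t dr dc (A + B).
Proof.
move=> hA hB k l; rewrite mxE.
case: (hA k l) => [->|[le hAkl]]; first by rewrite add0r.
case: (hB k l) => [->|[_ hBkl]]; first by rewrite addr0; right.
by right; split=> //; rewrite rpredD.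
Qed.

Lemma gmxN t r s (dr : 'I_r -> nat) (dc : 'I_s -> nat)
    (A : 'M[{mpoly K[n]}]_(r, s)) :
  gmx t dr dc A -> gmx t dr dc (- A).
Proof.
move=> hA k l; rewrite mxE.
case: (hA k l) => [->|[le hAkl]]; first by rewrite oppr0; left.
by right; rewrite rpredN.
Qed.

Lemma gmxM t t' r m s (dr : 'I_r -> nat) (dm : 'I_m -> nat) (dc : 'I_s -> nat)
    (A : 'M[{mpoly K[n]}]_(r, m)) (B : 'M_(m, s)) :
  gmx t dr dm A -> gmx t' dm dc B -> gmx (t + t') dr dc (A *m B).
Proof.
move=> hA hB k l; rewrite mxE.
apply: (big_ind (fun p => p = 0 \/
    (dc l + (t + t') <= dr k)%N /\ p \is (dr k - dc l).-homog)).
- by left.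
- move=> x y [->|[le hx]]; first by rewrite add0r.
  case=> [->|[_ hy]]; first by rewrite addr0; right.
  by right; split=> //; rewrite rpredD.
move=> j _; case: (hA k j) => [->|[le1 h1]]; first by rewrite mul0r; left.
case: (hB j l) => [->|[le2 h2]]; first by rewrite mulr0; left.
right; split; first lia.
have -> : (dr k - dc l = (dr k - dm j) + (dm j - dc l))%N by lia.
exact: dhomogM.
Qed.

Lemma gmx1 r (d : 'I_r -> nat) : gmx 0 d d (1%:M : 'M[{mpoly K[n]}]_r).
Proof.
move=> k l; rewrite mxE; case: eqP => [->|_]; last by left.
by right; rewrite addn0 subnn dhomog1.
Qed.

Lemma gmx_rowsub t r s q (dr : 'I_r -> nat) (dc : 'I_s -> nat)
    (f : 'I_q -> 'I_r) (A : 'M[{mpoly K[n]}]_(r, s)) :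
  gmx t dr dc A -> gmx t (dr \o f) dc (rowsub f A).
Proof. by move=> hA k l; rewrite mxE; apply: hA. Qed.

(** Any lift can be made homogeneous: keep from each entry of [W] only its component of the expected
    degree. Comparing components of degree [dr k - dc l] in [V = W *m D] shows that the truncated
    matrix still lifts [V]. *)
Lemma gmx_lift t r m s (dr : 'I_r -> nat) (dm : 'I_m -> nat)
    (dc : 'I_s -> nat) (V : 'M[{mpoly K[n]}]_(r, s)) (D : 'M_(m, s)) :
  gmx 0 dr dc V -> gmx t dm dc D -> (exists W, V = W *m D) ->
  exists2 W, V = W *m D & gmx 0 dr dm W.
Proof.
move=> hV hD [W defV].
exists (\matrix_(k, j)
  if (dm j <= dr k)%N then pihomog mdeg (dr k - dm j) (W k j) else 0); last first.
  move=> k j; rewrite mxE; case: leqP => le; last by left.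
  by right; rewrite addn0 pihomogP.
apply/matrixP => k l; rewrite mxE.
case: (leqP (dc l) (dr k)) => [le|lt]; last first.
  case: (hV k l) => [->|[? _]]; last lia.
  rewrite big1 // => j _; rewrite mxE.
  case: (hD j l) => [->|[? _]]; first by rewrite mulr0.
  by rewrite ifF ?mul0r //; lia.
have -> : V k l = pihomog mdeg (dr k - dc l) (V k l).
  by case: (hV k l) => [->|[_ h]]; rewrite ?pihomog0 // pihomog_dE.
rewrite {1}defV mxE raddf_sum; apply: eq_bigr => j _; rewrite mxE /=.
case: (hD j l) => [->|[le' h]]; first by rewrite !mulr0 pihomog0.
rewrite (pihomogM_dhomog _ _ h).
case: (leqP (dm j) (dr k)) => hj; last by rewrite mul0r ifF //; lia.
by rewrite ifT; [congr (pihomog _ _ _ * _)|]; lia.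
Qed.

(* Neumann series: [1 + A] is inverted modulo ever more degree-lowering
   remainders, and a matrix lowering degrees by more than [max d] vanishes. *)
Lemma gmx_unitriangular_inv r (d : 'I_r -> nat) (A : 'M[{mpoly K[n]}]_r) :
  gmx 1 d d A -> exists2 P, (1%:M + A) *m P = 1%:M & gmx 0 d d P.
Proof.
move=> hA.
have approx t : exists P Q,
    [/\ (1%:M + A) *m P = 1%:M + Q, gmx 0 d d P & gmx t d d Q].
  elim: t => [|t [P [Q [eP hP hQ]]]].
    by exists 1%:M, A; split; [rewrite mulmx1 | apply: gmx1 | apply: gmxW hA].
  exists (P - Q), (- (A *m Q)); split.
  - by rewrite mulmxBr eP mulmxDl mul1mx opprD addrA addrK.
  - by apply: gmxD hP (gmxN _); apply: gmxW hQ.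
  - exact/gmxN/(gmxM hA hQ).
have [P [Q [eP hP hQ]]] := approx (\max_k d k).+1.
exists P => //; rewrite eP; suff -> : Q = 0 by rewrite addr0.
apply/matrixP => k l; rewrite mxE; case: (hQ k l) => // -[le _].
by have : (d k <= \max_j d j)%N; [exact: leq_bigmax | lia].
Qed.

End Ops.

Lemma gmx_map n n' (h : {mpoly K[n]} -> {mpoly K[n']}) t r s
    (dr : 'I_r -> nat) (dc : 'I_s -> nat) (A : 'M_(r, s)) :
  h 0 = 0 -> (forall d p, p \is d.-homog -> h p \is d.-homog) ->
  gmx t dr dc A -> gmx t dr dc (map_mx h A).
Proof.
move=> h0 hh hA k l; rewrite mxE.
by case: (hA k l) => [->|[le hp]]; [left|right; split=> //; apply: hh].
Qed.

(** Take a generating set of rows of least size. A relation with a nonzero constant coefficient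
    would express one chosen row through the others, against minimality. *)
Lemma min_generators n r s (G : 'M[{mpoly K[n]}]_(r, s)) :
  exists q (f : 'I_q -> 'I_r),
    (exists C, G = C *m rowsub f G) /\
    (forall (c : 'rV_q) i a, c *m rowsub f G = 0 -> c 0 i = a%:MP -> a = 0).
Proof.
pose gen q := exists (f : 'I_q -> 'I_r) C, G = C *m rowsub f G.
have [q [[f [C eC]] qmin]] : exists q, gen q /\ forall q', (q' < q)%N -> ~ gen q'.
  have : gen r.
    by exists id, 1%:M; rewrite mul1mx; apply/matrixP=> i j; rewrite mxE.
  move: (r) => k; elim/ltn_ind: k => k IH gk.
  have [[k' [lt gk']]|no] := classic (exists k', (k' < k)%N /\ gen k').
    exact: IH lt gk'.
  by exists k; split=> // k' lt gk'; apply: no; exists k'.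
exists q, f; split; first by exists C.
move=> c i a rel ci; apply/eqP/negPn/negP => nz.
case: q f C eC qmin c i rel ci => [|q] f C eC qmin c i rel ci; first by case: i ci.
apply: (qmin q) => //; exists (f \o lift i).
(* Subtracting multiples of the relation, scaled so that its [i]-th coefficient is 1, clears column
   [i] of [C] without changing the product. *)
pose C' := C - col i C *m (a^-1%:MP *: c).
have eC' : G = C' *m rowsub f G.
  by rewrite mulmxBl -eC -mulmxA -scalemxAl rel scaler0 mulmx0 subr0.
have C'i k : C' k i = 0.
  rewrite !mxE big_ord1 !mxE ci -mpolyCM mulVf // mpolyC1 mulr1 subrr //.
exists (colsub (lift i) C'); rewrite {1}eC'.
apply/matrixP=> k l; rewrite !mxE (bigD1_ord i) //= C'i mul0r add0r.
by apply: eq_bigr => j _; rewrite !mxE.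
Qed.

End GradedMatrices.

(** * Transfer of minimal resolutions along a graded retract *)

Section Retract.
Variables (K : fieldType) (M N : nat).
Variables (iota : {rmorphism {mpoly K[M]} -> {mpoly K[N]}})
          (phi : {rmorphism {mpoly K[N]} -> {mpoly K[M]}}).
Hypothesis iotaK : cancel iota phi.
Hypothesis iota_homog : forall d p, p \is d.-homog -> iota p \is d.-homog.
Hypothesis phi_homog : forall d p, p \is d.-homog -> phi p \is d.-homog.

(* [ZE] and [ZF] are the submodules (cycles of the two resolutions under
   comparison) that the next free modules must cover. *)
Definition retraction bE (dE : 'I_bE -> nat) bF (dF : 'I_bF -> nat)
    (ZE : 'rV[{mpoly K[M]}]_bE -> Prop) (ZF : 'rV[{mpoly K[N]}]_bF -> Prop)
    (alpha : 'M_(bE, bF)) (beta : 'M_(bF, bE)) : Prop :=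
  [/\ gmx 0 dE dF alpha, gmx 0 dF dE beta, map_mx phi alpha *m beta = 1%:M,
      (forall v, ZE v -> ZF (map_mx iota v *m alpha)) &
      (forall w, ZF w -> ZE (map_mx phi w *m beta))].

(* The rows of [phi D *m beta] span [ZE] because [v] is recovered from its
   image under [alpha]. With a minimal spanning subset, the composite
   [alpha; beta] on the new free modules is unitriangular for the degrees, so
   [beta] can be corrected to make it the identity. *)
Lemma retraction_step bE (dE : 'I_bE -> nat) bF (dF : 'I_bF -> nat)
    (ZE : 'rV_bE -> Prop) (ZF : 'rV_bF -> Prop) alpha beta
    b' (d' : 'I_b' -> nat) (D : 'M_(b', bF)) :
  retraction dE dF ZE ZF alpha beta -> gmx 1 d' dF D ->
  (forall w, ZF w <-> exists u, w = u *m D) ->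
  exists q (f : 'I_q -> 'I_b') (DE : 'M_(q, bE)) alpha' beta',
    [/\ gmx 1 (d' \o f) dE DE, (forall v, ZE v <-> exists u, v = u *m DE) &
        retraction (d' \o f) d' (fun v => v *m DE = 0) (fun w => w *m D = 0)
                   alpha' beta'].
Proof.
move=> [ha hb ab ZEF ZFE] hD ZFP.
pose G := map_mx phi D *m beta.
have hG : gmx 1 d' dE G.
  exact: gmxM (gmx_map (rmorph0 phi) phi_homog hD) hb.
have [q [f [genG minG]]] := min_generators G.
set DE := rowsub f G in genG minG.
have hDE : gmx 1 (d' \o f) dE DE by apply: gmx_rowsub.
have [C eC hC] := gmx_lift (gmxW (leqnSn 0) hG) hDE genG.
have phiK m n (A : 'M_(m, n)) : map_mx phi (map_mx iota A) = A.
  by apply/matrixP => i j; rewrite !mxE iotaK.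
have ZEP v : ZE v <-> exists u, v = u *m DE.
  split=> [/ZEF/ZFP[u eu]|[u ->]].
    exists (map_mx phi u *m C); rewrite -mulmxA -eC /G mulmxA -map_mxM -eu.
    by rewrite map_mxM phiK -mulmxA ab mulmx1.
  rewrite /DE -[G]mul1mx -mul_rowsub_mx /G !mulmxA.
  rewrite -[u *m _]phiK -map_mxM; apply: ZFE; apply/ZFP.
  by exists (map_mx iota (u *m rowsub f 1%:M)).
exists q, f, DE.
have [alpha' ea ha'] : exists2 alpha', map_mx iota DE *m alpha = alpha' *m D &
    gmx 0 (d' \o f) d' alpha'.
  apply: gmx_lift hD _.
    apply: (gmxM (t:=0) _ ha); apply: gmx_map (rmorph0 iota) iota_homog _.
    exact: gmxW hDE.
  have rowP k : exists u, row k (map_mx iota DE *m alpha) = u *m D.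
    apply/ZFP; rewrite row_mul -map_row; apply/ZEF/ZEP.
    by exists (delta_mx 0 k); rewrite -rowE.
  have [U eU] := fin_all_exists rowP.
  exists (\matrix_k U k); apply/row_matrixP => k.
  by rewrite eU row_mul rowK.
(* The composite of [alpha'] with the uncorrected [C], read over the smaller ring. It fixes [DE], so
   the rows of [u - 1] are relations between the rows of [DE]. *)
pose u := map_mx phi alpha' *m C.
have uDE : u *m DE = DE.
  rewrite /u -mulmxA -eC /G mulmxA -map_mxM -ea map_mxM phiK -mulmxA ab.
  exact: mulmx1.
have hu : gmx 0 (d' \o f) (d' \o f) u.
  exact: gmxM (gmx_map (rmorph0 phi) phi_homog ha') hC.
have hu1 : gmx 1 (d' \o f) (d' \o f) (u - 1%:M).
  move=> k l; case: (gmxD hu (gmxN (gmx1 _ _ _)) k l) => [->|[le h]]; first by left.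
  case: (ltnP (d' (f l)) (d' (f k))) => [lt|ge].
    by right; rewrite addn1.
  (* No degree drop: the entry is homogeneous of degree 0, hence a constant coefficient of a
     relation, and minimality of the generators makes it zero. *)
  left; rewrite /= (eqP ge) in h; have := dhomog0_const h.
  set a := _@_0 => ea0.
  suff a0 : a = 0 by rewrite ea0 a0 mpolyC0.
  apply: (minG (row k (u - 1%:M)) l); last by rewrite mxE.
  by rewrite -row_mul mulmxBl uDE mul1mx subrr row0.
have [P uP hP] := gmx_unitriangular_inv hu1.
rewrite [1%:M + _]addrC subrK in uP.
(* The inverse [P] of [u] fixes [DE] as well, so replacing [C] by [C *m P] preserves compatibility
   with the differentials. *)
have PDE : P *m DE = DE by rewrite -{1}uDE mulmxA (mulmx1C uP) mul1mx.
exists alpha', (C *m P); split=> //; split=> //.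
- exact: gmxM hC hP.
- by rewrite mulmxA.
- by move=> v v0; rewrite -mulmxA -ea mulmxA -map_mxM v0 map_mx0 mul0mx.
- move=> w w0; rewrite -!mulmxA PDE -eC /G mulmxA -map_mxM w0.
  by rewrite map_mx0 mul0mx.
Qed.

(** * Recursive construction of the resolution *)

Section Tower.
Variables (b : nat -> nat) (d : forall i, 'I_(b i) -> nat)
  (D : forall i, 'M[{mpoly K[N]}]_(b i.+1, b i)).
Hypothesis D_gmx : forall i, gmx 1 (@d i.+1) (@d i) (D i).

(** The state of the recursion in homological degree [i]. [stageE] and [stageF] are the given ideals
    for [i = 0] and the cycles afterwards. [stage_ind] remembers which generator of F_i supplied
    each degree in E_i. *)
Record stage i := Stage {
  stage_rank : nat;
  stage_ind : 'I_stage_rank -> 'I_(b i);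
  stage_deg : 'I_stage_rank -> nat;
  stageE : 'rV[{mpoly K[M]}]_stage_rank -> Prop;
  stageF : 'rV[{mpoly K[N]}]_(b i) -> Prop;
  stage_alpha : 'M_(stage_rank, b i);
  stage_beta : 'M_(b i, stage_rank);
  stage_degE : forall k, stage_deg k = d (stage_ind k);
  stageFP : forall w, stageF w <-> exists u, w = u *m D i;
  stage_retract :
    retraction stage_deg (@d i) stageE stageF stage_alpha stage_beta }.

Hypothesis D_exact : forall i (w : 'rV_(b i.+1)),
  w *m D i = 0 <-> exists u, w = u *m D i.+1.

(** The retraction step yields mere existence; indefinite description turns it into data, on which
    one can recurse over [i]. *)
Lemma next_stage i (s : stage i) :
  {s' : stage i.+1 & {DE : 'M_(stage_rank s', stage_rank s) |
    [/\ gmx 1 (@stage_deg _ s') (@stage_deg _ s) DE,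
        (forall v, stageE v <-> exists u, v = u *m DE) &
        forall v, @stageE _ s' v <-> v *m DE = 0]}}.
Proof.
suff /constructive_indefinite_description[[s' DE] h] : exists p : {s' : stage i.+1 &
    'M[{mpoly K[M]}]_(stage_rank s', stage_rank s)},
  [/\ gmx 1 (@stage_deg _ (tag p)) (@stage_deg _ s) (tagged p),
      (forall v, @stageE _ s v <-> exists u, v = u *m tagged p) &
        forall v, @stageE _ (tag p) v <-> v *m tagged p = 0].
  by exists s', DE.
have [q [f [DE [al [be [h1 h2 h3]]]]]] :=
  retraction_step (stage_retract s) (@D_gmx i) (@stageFP _ s).
by exists (existT _ (@Stage i.+1 q f _ _ _ _ _ (fun=> erefl) (@D_exact i) h3) DE).
Qed.

End Tower.

Lemma reg_le_retract (JE : pred {mpoly K[M]}) (JF : pred {mpoly K[N]}) r :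
  (forall p, JE p -> JF (iota p)) -> (forall p, JF p -> JE (phi p)) ->
  reg_le JF r -> reg_le JE r.
Proof.
move=> JEF JFE [b [d [D [[b0 d0 J0 cx [ex hD [L hL]]] reg]]]].
have D_gmx i : gmx 1 (@d i.+1) (@d i) (D i).
  move=> k l; have [h nz] := hD i k l.
  by case: (eqVneq (D i k l) 0) => [|/nz lt]; [left|right; rewrite addn1].
have D_exact i (w : 'rV_(b i.+1)) : w *m D i = 0 <-> exists u, w = u *m D i.+1.
  by split=> [/ex //|[u ->]]; rewrite -mulmxA cx mulmx0.
(* [b 0] equals 1 only by a proof, so constant rows replace a cast; likewise [const_mx 1] below is
   the rank-one identity. *)
pose ZF (w : 'rV_(b 0%N)) := exists2 p, JF p & w = const_mx p.
have ZFP w : ZF w <-> exists u, w = u *m D 0%N.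
  split=> [[p /J0[u eu] ->]|[u ew]].
    by exists u; apply/rowP => j; rewrite eu mxE.
  have j0 : 'I_(b 0%N) by rewrite b0; exact: ord0.
  have j0E j : j = j0.
    by apply/val_inj; case: j j0 => [j lj] [j' lj'] /=; lia.
  exists (w 0 j0); first by apply/J0; exists u => j; rewrite ew (j0E j).
  by apply/rowP => j; rewrite mxE (j0E j).
have f0 : 'I_1 -> 'I_(b 0%N) by rewrite b0.
pose ZE (v : 'rV[{mpoly K[M]}]_1) := JE (v 0 0).
have base : retraction (fun _ : 'I_1 => 0%N) (@d 0%N) ZE ZF
    (const_mx 1) (const_mx 1).
  split=> [k l|k l||v vE|w [p pF ->]].
  - by right; rewrite mxE d0 dhomog1.
  - by right; rewrite mxE d0 dhomog1.
  - apply/matrixP => k l; rewrite !ord1 !mxE (eq_bigr (fun=> 1)).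
      by rewrite sumr_const card_ord b0.
    by move=> j _; rewrite !mxE rmorph1 mulr1.
  - exists (iota (v 0 0)); first exact: JEF.
    by apply/matrixP => k l; rewrite !mxE big_ord1 !mxE mulr1 ord1.
  - rewrite /ZE !mxE (eq_bigr (fun=> phi p)).
      by rewrite sumr_const card_ord b0; apply: JFE.
    by move=> j _; rewrite !mxE mulr1.
pose s0 := @Stage b d D 0 1 f0 (fun=> 0%N) ZE ZF _ _ (fun=> esym (d0 _)) ZFP base.
pose step i (s : stage d D i) := next_stage D_gmx D_exact s.
pose st i := nat_rect (stage d D) s0 (fun i s => tag (step i s)) i.
pose DE i : 'M_(stage_rank (st i.+1), stage_rank (st i)) :=
  sval (tagged (step i (st i))).
have DEP i : [/\ gmx 1 (@stage_deg _ _ _ _ (st i.+1)) (@stage_deg _ _ _ _ (st i)) (DE i),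
        (forall v, @stageE _ _ _ _ (st i) v <-> exists u, v = u *m DE i) &
        forall v, @stageE _ _ _ _ (st i.+1) v <-> v *m DE i = 0].
  exact: (svalP (tagged (step i (st i)))).
exists (fun i => stage_rank (st i)), (fun i => @stage_deg _ _ _ _ (st i)), DE.
split; last by move=> i k; rewrite stage_degE; apply: reg.
have DE_exact i (v : 'rV_(_)) : v *m DE i = 0 <-> exists u, v = u *m DE i.+1.
  have [_ _ h] := DEP i; have [_ h' _] := DEP i.+1.
  exact: iff_trans (iff_sym (h v)) (h' v).
split=> //.
- move=> p; have [_ h _] := DEP 0%N; split=> [Jp|[u eu]].
    have [u eu] : exists u : 'rV_(_), const_mx p = u *m DE 0%N by apply/h; rewrite /= /ZE mxE.
    by exists u => j; rewrite -eu mxE.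
  have /h : exists u' : 'rV_(_), u *m DE 0%N = u' *m DE 0%N by exists u.
  by rewrite /= /ZE eu.
- move=> i; apply/row_matrixP => k; rewrite row_mul row0.
  by apply/DE_exact; exists (delta_mx 0 k); rewrite -rowE.
split.
- by move=> i v /DE_exact.
- move=> i k l; have [h _ _] := DEP i.
  case: (h k l) => [->|[]]; first by rewrite rpred0 eqxx.
  by rewrite addn1.
(* Finite length is inherited: [stage_ind] maps the generators of E_i to those of F_i, so E_i
   vanishes with F_i. *)
- exists L => i lt; have := @stage_ind _ _ _ _ (st i).
  case: (stage_rank _) => // n /(_ ord0); rewrite (hL i lt).
  by case.
Qed.

End Retract.

(** * Substitutions sending each variable to a variable or to zero *)

Section VariableMaps.
Variable K : fieldType.

Lemma mpoly_rmorph_ext n (R : comNzRingType) (f g : {rmorphism {mpoly K[n]} -> R}) :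
  (forall c, f c%:MP = g c%:MP) -> (forall i, f 'X_i = g 'X_i) -> f =1 g.
Proof.
move=> fgC fgX p; rewrite (mpolyE p) !rmorph_sum; apply: eq_bigr => m _.
rewrite -mul_mpolyC !rmorphM fgC mpolyXE_id !rmorph_prod; congr (_ * _).
by apply: eq_bigr => i _; rewrite !rmorphXn fgX.
Qed.

(** [None] marks a variable sent to zero, so one form covers both the inclusions and the
    retractions. *)
Definition var_map m n (g : 'I_m -> option 'I_n) :
    {rmorphism {mpoly K[m]} -> {mpoly K[n]}} :=
  comp_mpoly [tuple oapp (fun a => 'X_a) 0 (g k) | k < m].

Lemma comp_mpolyXU_tuple m n (F : 'I_m -> {mpoly K[n]}) i :
  'X_i \mPo [tuple F k | k < m] = F i.
Proof. by rewrite comp_mpolyXU -tnth_nth tnth_mktuple. Qed.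

Lemma var_mapX m n (g : 'I_m -> option 'I_n) i :
  var_map g 'X_i = oapp (fun a => 'X_a) 0 (g i).
Proof. exact: comp_mpolyXU_tuple. Qed.

Lemma var_mapC m n (g : 'I_m -> option 'I_n) c : var_map g c%:MP = c%:MP.
Proof. exact: comp_mpolyC. Qed.

Lemma var_map_homog m n (g : 'I_m -> option 'I_n) d p :
  p \is d.-homog -> var_map g p \is d.-homog.
Proof.
move=> /dhomogP hp; rewrite /= comp_mpolyEX big_seq rpred_sum // => mm /hp.
rewrite [LHS]mdegE => <-; apply: dhomogZ; rewrite comp_mpolyX.
apply: (big_ind2 (fun p d => p \is d.-homog)); first exact: dhomog1.
  by move=> *; apply: dhomogM.
move=> i _; rewrite tnth_mktuple -[X in X.-homog]mul1n; apply: dhomogMn.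
by case: (g i) => [a|]; rewrite ?rpred0 // dhomogX; apply/eqP/mdeg1.
Qed.

Lemma eq_var_map m n (g h : 'I_m -> option 'I_n) :
  g =1 h -> var_map g =1 var_map h.
Proof.
by move=> gh; apply: mpoly_rmorph_ext => [c|i]; rewrite ?var_mapC // !var_mapX gh.
Qed.

Lemma var_map_comp m n k (h : 'I_m -> option 'I_n) (g : 'I_n -> option 'I_k) p :
  var_map g (var_map h p) = var_map (fun i => obind g (h i)) p.
Proof.
apply: (mpoly_rmorph_ext (f := var_map g \o var_map h)) p => [c|i] /=.
  by rewrite !comp_mpolyC.
rewrite -!/(var_map _ _) !var_mapX; case: (h i) => [a|] /=; last exact: rmorph0.
exact: var_mapX.
Qed.

Lemma var_map_some m (p : {mpoly K[m]}) : var_map some p = p.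
Proof. exact: comp_mpoly_id. Qed.

(** Both ideals are kernels of substitutions. The hypotheses on [h] and [h'] give commuting squares
    with the inclusion and the retraction, so each kernel is carried into the other. *)
Lemma reg_le_var_map m n k l (g : 'I_m -> 'I_n) (g' : 'I_n -> option 'I_m)
    (h : 'I_k -> option 'I_l) (h' : 'I_l -> option 'I_k)
    (tE : 'I_m -> {mpoly K[k]}) (tF : 'I_n -> {mpoly K[l]}) r :
  pcancel g g' ->
  (forall i, var_map h (tE i) = tF (g i)) ->
  (forall i, var_map h' (tF i) = oapp tE 0 (g' i)) ->
  reg_le (fun p => p \mPo [tuple tF i | i < n] == 0) r ->
  reg_le (fun p => p \mPo [tuple tE i | i < m] == 0) r.
Proof.
move=> gK htE htF.
apply: (@reg_le_retract K m n (var_map (some \o g)) (var_map g')) => //.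
- move=> p; rewrite var_map_comp -[RHS]var_map_some; apply: eq_var_map => i /=.
  exact: gK.
- by move=> *; apply: var_map_homog.
- by move=> *; apply: var_map_homog.
- move=> p /eqP p0; apply/eqP; rewrite -[RHS](rmorph0 (var_map h)) -p0.
  move: p {p0}; apply: (mpoly_rmorph_ext (f := comp_mpoly _ \o var_map (some \o g))
    (g := var_map h \o comp_mpoly _)) => [c|i] /=.
    by rewrite !comp_mpolyC.
  by rewrite !comp_mpolyXU_tuple -htE.
- move=> p /eqP p0; apply/eqP; rewrite -[RHS](rmorph0 (var_map h')) -p0.
  move: p {p0}; apply: (mpoly_rmorph_ext (f := comp_mpoly _ \o var_map g')
    (g := var_map h' \o comp_mpoly _)) => [c|i] /=.
    by rewrite !comp_mpolyC.
  rewrite !comp_mpolyXU_tuple -/(var_map h' _) htF.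
  by case: (g' i) => [a|] /=; rewrite ?comp_mpolyXU_tuple ?comp_mpoly0.
Qed.

Definition pinv (S T : finType) (f : S -> T) (y : T) : option S :=
  [pick x | f x == y].

Lemma pinvK (S T : finType) (f : S -> T) : injective f -> pcancel f (pinv f).
Proof.
move=> injf x; rewrite /pinv; case: pickP => [y /eqP/injf -> //|/(_ x)].
by rewrite eqxx.
Qed.

(** * Fiber and Rees presentations under an embedding of generators *)

Section Generators.
Variables (N N' : nat) (f : seq {mpoly K[N]}) (f' : seq {mpoly K[N']}).
Variables (g : 'I_N -> 'I_N') (gT : 'I_(size f) -> 'I_(size f')).
Hypotheses (g_inj : injective g) (gT_inj : injective gT).
Hypothesis f_map : forall j : 'I_(size f), var_map (some \o g) f`_j = f'`_(gT j).
Hypothesis f_out : forall j : 'I_(size f'), j \notin codom gT -> var_map (pinv g) f'`_j = 0.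

Lemma var_map_pinv_gens (j : 'I_(size f')) :
  var_map (pinv g) f'`_j = oapp (fun a : 'I_(size f) => f`_a) 0 (pinv gT j).
Proof.
rewrite {2}/pinv; case: pickP => [a /eqP <-|no] /=.
  rewrite -f_map -/(var_map _ _) var_map_comp -[RHS]var_map_some.
  by apply: eq_var_map => i /=; apply: pinvK.
by apply: f_out; apply/negP => /codomP[a ea]; have := no a; rewrite ea eqxx.
Qed.

Lemma fiber_reg_le r : reg_le (fiber_ideal f') r -> reg_le (fiber_ideal f) r.
Proof. exact: reg_le_var_map (pinvK gT_inj) f_map var_map_pinv_gens. Qed.

Definition split_map (T : Type) m n (u : 'I_m -> T) (v : 'I_n -> T)
  (k : 'I_(m + n)) : T := match split k with inl a => u a | inr b => v b end.

Lemma split_mapL T m n (u : 'I_m -> T) (v : 'I_n -> T) a :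
  split_map u v (lshift n a) = u a.
Proof. by rewrite /split_map (unsplitK (inl a)). Qed.

Lemma split_mapR T m n (u : 'I_m -> T) (v : 'I_n -> T) b :
  split_map u v (rshift m b) = v b.
Proof. by rewrite /split_map (unsplitK (inr b)). Qed.

(** The last variable is the Rees parameter t, which every map fixes. *)
Definition lift_var m n (u : 'I_m -> option 'I_n) (k : 'I_m.+1) : option 'I_n.+1 :=
  if unlift ord_max k is Some a then omap (lift ord_max) (u a) else Some ord_max.

Lemma widen_lift n (a : 'I_n) : widen_ord (leqnSn n) a = lift ord_max a.
Proof. by apply/val_inj; rewrite /= /bump leqNgt ltn_ord. Qed.

Lemma lift_var_widen m n (u : 'I_m -> option 'I_n) a :
  lift_var u (widen_ord (leqnSn m) a) = omap (widen_ord (leqnSn n)) (u a).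
Proof.
rewrite widen_lift /lift_var liftK; case: (u a) => //= b.
by rewrite widen_lift.
Qed.

Lemma lift_var_max m n (u : 'I_m -> option 'I_n) :
  lift_var u ord_max = Some ord_max.
Proof. by rewrite /lift_var unlift_none. Qed.

Lemma var_map_liftN m n (u : 'I_m -> option 'I_n) (p : {mpoly K[m]}) :
  var_map (lift_var u) (liftN p) = liftN (var_map u p).
Proof.
have liftNE k (q : {mpoly K[k]}) :
  liftN q = var_map (some \o widen_ord (leqnSn k)) q by [].
rewrite !liftNE !var_map_comp; apply: eq_var_map => i /=.
by rewrite lift_var_widen; case: (u i).
Qed.

(** The ring variables are transformed by [g] and the T-variables by [gT], independently; on the
    target side t is kept. *)
Lemma rees_reg_le r : reg_le (rees_ideal f') r -> reg_le (rees_ideal f) r.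
Proof.
apply: (@reg_le_var_map _ _ _ _
  (split_map (fun a => lshift _ (g a)) (fun j => rshift _ (gT j)))
  (split_map (fun a => omap (fun c => lshift _ c) (pinv g a))
             (fun j => omap (fun c => rshift _ c) (pinv gT j)))
  (lift_var (some \o g)) (lift_var (pinv g))
  (split_map (fun a => 'X_(widen_ord (leqnSn N) a))
             (fun j => liftN f`_j * 'X_(ord_max : 'I_N.+1)))
  (split_map (fun a => 'X_(widen_ord (leqnSn N') a))
             (fun j => liftN f'`_j * 'X_(ord_max : 'I_N'.+1)))).
- move=> k; rewrite -(splitK k); case: (split k) => [a|j] /=.
    by rewrite !split_mapL pinvK.
  by rewrite !split_mapR pinvK.
- move=> k; rewrite -(splitK k); case: (split k) => [a|j] /=.
    by rewrite !split_mapL -/(var_map _ _) var_mapX lift_var_widen.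
  rewrite !split_mapR -/(var_map _ _) rmorphM var_mapX lift_var_max.
  by rewrite var_map_liftN f_map.
- move=> k; rewrite -(splitK k); case: (split k) => [a|j] /=.
    rewrite !split_mapL -/(var_map _ _) var_mapX lift_var_widen.
    by case: (pinv g a) => //= b; rewrite split_mapL.
  rewrite !split_mapR -/(var_map _ _) rmorphM var_mapX lift_var_max.
  rewrite var_map_liftN var_map_pinv_gens.
  case: (pinv gT j) => [b|] /=; first by rewrite split_mapR.
  by rewrite /liftN comp_mpoly0 mul0r.
Qed.

End Generators.

End VariableMaps.

(** * Binomial edge ideals of induced subgraphs *)

Lemma ltn_enum_val n (V : {set 'I_n}) (a b : 'I_#|V|) :
  (enum_val a < enum_val b)%N = (a < b)%N.
Proof.
have mono (x y : 'I_#|V|) : (x < y)%N -> (enum_val x < enum_val y)%N.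
  move=> xy; have x0 := enum_val x.
  rewrite !(enum_val_nth x0).
  have srt : sorted (relpre val ltn) (enum V).
    (* A sublist of the increasing list of all vertices is increasing. *)
    have -> : enum V = filter (mem V) (enum 'I_n) by rewrite enumT.
    apply: sorted_filter; first by move=> i j k; apply: ltn_trans.
    by rewrite -sorted_map val_enum_ord iota_ltn_sorted.
  apply: (sorted_ltn_nth _ x0 srt) => //; rewrite ?inE -?cardE //.
  by move=> i j k; apply: ltn_trans.
case: (ltngtP a b) => [/mono //|/mono lt|/val_inj ->]; last by rewrite ltnn.
by apply/negbTE; rewrite -leqNgt ltnW.
Qed.

(** Positions in a generator list are traded for the edge pairs they come from, so that generators
    can be matched combinatorially. *)
Lemma enum_image_index (T : finType) (P : pred T) (R : nmodType) (F : T -> R) :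
  exists idx : 'I_(size [seq F q | q <- enum P]) -> T,
    [/\ injective idx, (forall j, P (idx j)), (forall q, P q -> exists j, idx j = q) &
        forall j : 'I_(size [seq F q | q <- enum P]),
          [seq F q | q <- enum P]`_j = F (idx j)].
Proof.
have sz : size [seq F q | q <- enum P] = #|P| by rewrite size_map -cardE.
exists (fun j => enum_val (cast_ord sz j)); split.
- by move=> i j /enum_val_inj/cast_ord_inj.
- by move=> j; apply: enum_valP.
- move=> q Pq; exists (cast_ord (esym sz) (enum_rank_in (Pq : q \in P) q)).
  by rewrite cast_ordKV enum_rankK_in.
- move=> j; have x0 := enum_val (cast_ord sz j).
  by rewrite (nth_map x0) -?cardE -?sz // (enum_val_nth x0).
Qed.

Lemma mxvec_index_inj m n (i i' : 'I_m) (j j' : 'I_n) :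
  mxvec_index i j = mxvec_index i' j' -> (i, j) = (i', j').
Proof. by move=> /cast_ord_inj/enum_rank_inj. Qed.

Section Induced.
Variables (K : fieldType) (n1 n2 : nat) (e1 : rel 'I_n1) (e2 : rel 'I_n2).
Variables (V1 : {set 'I_n1}) (V2 : {set 'I_n2}).

Definition emb_var (k : 'I_(#|V1| * #|V2|)) : 'I_(n1 * n2) :=
  let: (a, b) := enum_val (cast_ord (esym (mxvec_cast _ _)) k) in
  mxvec_index (enum_val a) (enum_val b).

Lemma emb_varE a b :
  emb_var (mxvec_index a b) = mxvec_index (enum_val a) (enum_val b).
Proof. by rewrite /emb_var /mxvec_index cast_ordK enum_rankK. Qed.

Lemma emb_var_inj : injective emb_var.
Proof.
move=> k k'; case/mxvec_indexP: k => a b; case/mxvec_indexP: k' => a' b'.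
by rewrite !emb_varE => /mxvec_index_inj[/enum_val_inj -> /enum_val_inj ->].
Qed.

Lemma var_map_xv_out i k : ~~ ((i \in V1) && (k \in V2)) ->
  var_map K (pinv emb_var) (xv K i k) = 0.
Proof.
move=> out; rewrite var_mapX /pinv; case: pickP => //= x /eqP.
case/mxvec_indexP: x => a b; rewrite emb_varE => /mxvec_index_inj[ei ek].
by case/negP: out; rewrite -ei -ek !enum_valP.
Qed.

Lemma bei_gens_induced :
  exists gT : 'I_(size (bei_gens K (induced e1 V1) (induced e2 V2))) ->
              'I_(size (bei_gens K e1 e2)),
    [/\ injective gT,
        forall j : 'I_(size (bei_gens K (induced e1 V1) (induced e2 V2))),
          var_map K (some \o emb_var)
          (bei_gens K (induced e1 V1) (induced e2 V2))`_j =
          (bei_gens K e1 e2)`_(gT j) &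
        forall j : 'I_(size (bei_gens K e1 e2)), j \notin codom gT ->
          var_map K (pinv emb_var) (bei_gens K e1 e2)`_j = 0].
Proof.
rewrite /bei_gens.
set P := [pred q : 'I_#|V1| * _ * _ * _ | _]; set F := (F in map F (enum P)).
set P' := [pred q : 'I_n1 * _ * _ * _ | _]; set F' := (F in map F (enum P')).
have [idx [idx_inj idxP idx_surj idxE]] := enum_image_index P F.
have [idx' [idx'_inj idx'P idx'_surj idx'E]] := enum_image_index P' F'.
pose emb (q : 'I_#|V1| * 'I_#|V1| * 'I_#|V2| * 'I_#|V2|) :=
  let: (a, b, c, d) := q in (enum_val a, enum_val b, enum_val c, enum_val d).
have emb_inj : injective emb.
  by move=> [[[a b] c] d] [[[a' b'] c'] d'] /= [] /enum_val_inj -> /enum_val_inj ->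
    /enum_val_inj -> /enum_val_inj ->.
have PE q : P' (emb q) = P q.
  by case: q => [[[a b] c] d]; rewrite /= !ltn_enum_val.
have FE q : var_map K (some \o emb_var) (F q) = F' (emb q).
  case: q => [[[a b] c] d].
  by rewrite /F /F' rmorphB !rmorphM !var_mapX /= !emb_varE.
have /fin_all_exists[gT gTE] j : exists j', idx' j' = emb (idx j).
  by apply: idx'_surj; rewrite PE; apply: idxP.
exists gT; split.
- by move=> i j /(congr1 idx'); rewrite !gTE => /emb_inj/idx_inj.
- by move=> j; rewrite idxE idx'E gTE FE.
move=> j' out; rewrite idx'E; case ej': (idx' j') (idx'P j') => [[[i j] k] l] P'q.
have [in4|out4] := boolP [&& i \in V1, j \in V1, k \in V2 & l \in V2].
  case/and4P: in4 => iV jV kV lV; case/negP: out.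
  pose q := (enum_rank_in iV i, enum_rank_in jV j,
             enum_rank_in kV k, enum_rank_in lV l).
  have eq : emb q = (i, j, k, l) by rewrite /emb /q !enum_rankK_in.
  (* Inducedness enters here: edges with all endpoints in [V1] and [V2] are edges of the subgraphs,
     so this generator would lie in the image of [gT]. *)
  have /idx_surj[j0 ej0] : P q by rewrite -PE eq.
  by apply/codomP; exists j0; apply: idx'_inj; rewrite gTE ej0 eq ej'.
rewrite /F' rmorphB !rmorphM.
(* Each monomial of the binomial involves all four indices, so an index outside the subgraphs puts a
   killed variable in both. *)
have prod0 u v s t : ~~ [&& u \in V1, v \in V1, s \in V2 & t \in V2] ->
    var_map K (pinv emb_var) (xv K u s) * var_map K (pinv emb_var) (xv K v t) = 0.
  have [/andP[-> ->] /= ?|/var_map_xv_out -> _] := boolP ((u \in V1) && (s \in V2)).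
    by rewrite [X in _ * X]var_map_xv_out ?mulr0.
  exact: mul0r.
by rewrite !prod0 ?subrr // [(l \in V2) && _]andbC.
Qed.

End Induced.

(** An inequality of regularities is expressed by transferring every upper bound [r]. *)
Theorem theorem5p4 (K : fieldType) (n1 n2 : nat) (e1 : rel 'I_n1) (e2 : rel 'I_n2)
  (V1 : {set 'I_n1}) (V2 : {set 'I_n2}) :
  simple_graph e1 -> simple_graph e2 ->
  (forall r : nat,
     reg_le (rees_ideal (bei_gens K e1 e2)) r ->
     reg_le (rees_ideal (bei_gens K (induced e1 V1) (induced e2 V2))) r) /\
  (forall r : nat,
     reg_le (fiber_ideal (bei_gens K e1 e2)) r ->
     reg_le (fiber_ideal (bei_gens K (induced e1 V1) (induced e2 V2))) r).
Proof.
move=> _ _; have [gT [gT_inj f_map f_out]] := bei_gens_induced K e1 e2 V1 V2.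
split=> r.
- exact: rees_reg_le (@emb_var_inj _ _ V1 V2) gT_inj f_map f_out r.
- exact: fiber_reg_le (@emb_var_inj _ _ V1 V2) gT_inj f_map f_out r.
Qed.
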